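(* Let $n\geq 2$ be an integer. The radical distance $d(M(K_n))$ of the graphic matroid of the complete graph $K_n$ on $n$ vertices is divisible by all primes $p\leq (n-1)/2$. In particular, $d(M(K_n))\geq e^{\vartheta\left(\frac{n-1}{2}\right)}$ grows at least exponentially in $n$.
   Context: Let $G$ be a finite graph with vertex set $V$ and edge set $S$, fix an orientation of each edge, and let $p$ be a prime. Let $(e_s)_{s\in S}$ be the standard basis of $\mathbb{F}_p^S=C^1(G,\mathbb{F}_p)$. For the graphic matroid $\underline{R}=M(G)$ put $U_{\mathbb{F}_p}=B^1(G,\mathbb{F}_p)\subset\mathbb{F}_p^S$, the span of the coboundaries $\delta_v=\sum_{s\text{ ending at }v}e_s-\sum_{s\text{ starting at }v}e_s$, $v\in V$, and $W=\mathbb{F}_p^S/U_{\mathbb{F}_p}=H^1(G,\mathbb{F}_p)$. The image of $e_s$ in $W$ is again denoted $e_s$. The mod $p$ Albanese graph $\mathrm{Alb}_p(\underline{R})$ is the oriented, $S$-colored graph with vertex set $W$ that has, for each $w\in W$ and $s\in S$, one positively oriented edge $[w\to w+e_s]$ of color $s$. $C_1(\mathrm{Alb}_p(\underline{R}),\mathbb{F}_p)$ is the $\mathbb{F}_p$-vector space of 1-chains, with basis the positively oriented edges, and $\partial[w\to w+e_s]=[w+e_s]-[w]$. A 1-chain of color $s$ is a linear combination of edges of color $s$. An $\mathbb{F}_p$-solution of $\underline{R}$ in $\mathrm{Alb}_p(\underline{R})$ is a collection $b=(b_s)_{s\in S}$ of 1-chains $b_s$ of color $s$ such that, whenever $c_s\in\mathbb{F}_p$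 satisfy $\sum_{s\in S}c_se_s\in U_{\mathbb{F}_p}\subset\mathbb{F}_p^S$, one has $\partial\sum_{s\in S}c_sb_s=0$. The number $\lambda_s(b_s)\in\mathbb{F}_p$ is the sum of the coefficients of $b_s$ with respect to the positively oriented edges of color $s$; the color profile of $b$ is $\lambda(b)=(\lambda_s(b_s))_{s\in S}\in\mathbb{F}_p^S$. It is constant if it equals $(c,\dots,c)$ for some $c\in\mathbb{F}_p$, and trivial if it is $0$. The radical distance $d(\underline{R})$ (to the class of cographic matroids) is the product of all primes $p$ such that any $\mathbb{F}_p$-solution of $\underline{R}$ in $\mathrm{Alb}_p(\underline{R})$ with constant color profile has trivial color profile. Chebyshev's theta function is $\vartheta(x)=\sum_{p\leq x}\log(p)$, sum over primes $p\leq x$. ''Grows at least exponentially'' means that there is a constant $C>1$ with $d(M(K_n))\geq C^n$ for all sufficiently large $n$. *)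

(* Defs.v *)
From HB Require Import structures.
From mathcomp Require Import all_boot all_order all_algebra.
From mathcomp Require Import all_classical all_reals all_analysis.

Set Implicit Arguments.
Unset Strict Implicit.
Unset Printing Implicit Defensive.

Import Order.TTheory GRing.Theory Num.Theory.
Local Open Scope ring_scope.

(* Loops and parallel edges are allowed; [source] and [target] record the
   chosen orientation of each edge. *)
Record ograph := OGraph {
  vertex : finType;
  edge : finType;
  source : edge -> vertex;
  target : edge -> vertex
}.

Definition is_complete_graph (n : nat) (G : ograph) : Prop :=
  [/\ #|vertex G| = n,
      forall s : edge G, source s != target s
    & forall u v : vertex G, u != v ->
        exists! s : edge G, [set source s; target s]%SET = [set u; v]%SET].

(* F_p^S; ['F_p] is the field with p elements only for p prime, and these
   definitions are only used for prime p. *)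
Notation FpS p S := {ffun S -> ('F_p)^o} (only parsing).

Definition basis_vec (p : nat) (S : finType) (s : S) : FpS p S :=
  [ffun t => (t == s)%:R].

Definition coboundary (p : nat) (G : ograph) (v : vertex G) : FpS p (edge G) :=
  \sum_(s : edge G | target s == v) basis_vec p s
  - \sum_(s : edge G | source s == v) basis_vec p s.

Definition B1 (p : nat) (G : ograph) : {vspace FpS p (edge G)} :=
  <<[seq coboundary p v | v : vertex G]>>%VS.

Section Albanese.
Variables (p : nat) (S : finType) (U : {vspace FpS p S}).

(* W = F_p^S / U *)
Definition quot_space : Type := Quotient.quot [the zmodClosed _ of pred_of_vspace U].

HB.instance Definition _ := GRing.Zmodule.on quot_space.
HB.instance Definition _ := generic_quotient.Quotient.on quot_space.
HB.instance Definition _ := Choice_isCountable.Build quot_space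
  (pcan_pickleK (can_pcan (@reprK _ quot_space))).

Lemma quot_space_enumP : Finite.axiom (undup [seq (\pi_quot_space v)%qT | v : FpS p S]).
Proof.
move=> w; rewrite count_uniq_mem ?undup_uniq // mem_undup.
by rewrite -[w]reprK map_f // mem_enum.
Qed.

HB.instance Definition _ := fintype.isFinite.Build quot_space quot_space_enumP.

Definition color_dir (s : S) : quot_space := (\pi_quot_space (basis_vec p s))%qT.

(* The coefficient of a 1-chain at (w, s) is that of the positively oriented
   edge [w -> w + e_s] of color s. *)
Definition chain1 := {ffun quot_space * S -> ('F_p)^o}.
Definition chain0 := {ffun quot_space -> ('F_p)^o}.

Definition vertex_chain (w : quot_space) : chain0 := [ffun v => (v == w)%:R].

Definition boundary (a : chain1) : chain0 :=
  \sum_(e : quot_space * S)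
    a e *: (vertex_chain (e.1 + color_dir e.2) - vertex_chain e.1).

Definition has_color (s : S) (a : chain1) : Prop :=
  forall (w : quot_space) (t : S), t != s -> a (w, t) = 0.

Definition is_solution (b : S -> chain1) : Prop :=
  (forall s, has_color s (b s)) /\
  (forall c : S -> ('F_p)^o, \sum_s c s *: basis_vec p s \in U ->
     boundary (\sum_s c s *: b s) = 0).

Definition color_profile (b : S -> chain1) : FpS p S :=
  [ffun s => \sum_(w : quot_space) b s (w, s)].

End Albanese.

Definition constant_profile (p : nat) (S : finType) (l : FpS p S) : Prop :=
  exists c : 'F_p, forall s : S, l s = c.

Definition radical_prime (G : ograph) (p : nat) : Prop :=
  prime p /\
  forall b : edge G -> chain1 (B1 p G),
    is_solution b -> constant_profile (color_profile b) -> color_profile b = 0.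

Local Open Scope classical_set_scope.

(* The product over an infinite set is 1 by convention, so a bound
   [1 < radical_distance G] entails that the set of primes is finite. *)
Definition radical_distance (G : ograph) : nat :=
  \big[muln/1%N]_(p \in [set p : nat | radical_prime G p]) p.

Definition chebyshev_theta (R : realType) (x : R) : R :=
  \sum_(p \in [set p : nat | prime p /\ p%:R <= x]) ln (p%:R : R).

(* Main.v *)
Require Import Defs.
From mathcomp Require Import all_boot all_order all_algebra finfield.
From mathcomp Require Import zify ring.

(** For a family of functions Q_v : W -> F_p, v ranging over the vertices, pair the
    relation of a solution attached to delta_v with Q_v and sum over v: if for every
    edge s the increment of Q_(target s) - Q_(source s) in the direction e_s is a
    constant t_s, then every solution satisfies sum_s t_s * lambda_s = 0.  For
    n >= 2 p + 1 choose vertices o, q and a set J of 2 p - 1 further vertices, and let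
    u_j be the holonomy of the loop o -> q -> j -> o.  The elementary symmetric
    polynomial e_p in the u_j changes by c^p = c when all u_j are increased by c, since
    'C(2 p - 1 - k, p - k) is divisible by p for 0 < k < p and is 1 mod p for k = 0.
    Hence Q_q = e_p(u) - u_j0 is invariant, and it extends to a family Q whose only
    nonzero t_s is the one of the edge joining q and j0: a constant profile vanishes.

    In the other direction, the tiling of space by permutohedra is a solution in every
    characteristic: its vertices are the orderings of the vertex set, put at their
    inversion vector, and its edges are the adjacent transpositions.  Moving the first
    vertex of an ordering to the end changes the inversion vector by a coboundary, which
    makes the chain closed.  Its profile is a constant between 1 and n!, so no prime
    above n! is radical, and the radical distance is a genuine finite product.

    The exponential growth is Chebyshev's estimate, from
    2^m <= 'C(2 m, m) <= (2 m)^(sqrt (2 m)) * prod_(p <= 2 m) p. *)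

Set Implicit Arguments.
Unset Strict Implicit.
Unset Printing Implicit Defensive.

Import Order.TTheory GRing.Theory Num.Theory.
Local Open Scope ring_scope.

(** * A lower bound for the primorial *)

Definition primorial (n : nat) : nat := (\prod_(p < n.+1 | prime p) p)%N.

Lemma primorial_gt0 (n : nat) : (0 < primorial n)%N.
Proof. by apply: prodn_cond_gt0 => p; apply: prime_gt0. Qed.

Lemma leq_primorial (m n : nat) : (m <= n)%N -> (primorial m <= primorial n)%N.
Proof.
rewrite -ltnS => le_mn; rewrite /primorial.
rewrite -!(big_mkord prime id) (@big_cat_nat _ _ _ m.+1 0 n.+1) //=.
by rewrite leq_pmulr //; apply: prodn_cond_gt0 => p; apply: prime_gt0.
Qed.

(** Vandermonde writes the central coefficient as the sum of the squares of the ['C(m, i)], while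
    the ['C(m, i)] themselves sum to 2^m. *)
Lemma exp2_leq_bin (m : nat) : (2 ^ m <= 'C(m + m, m))%N.
Proof.
rewrite -binomial.Vandermonde -[2%N]/(1 + 1)%N expnDn; apply: leq_sum => i _.
have le_im : (i <= m)%N by rewrite -ltnS.
by rewrite !exp1n !muln1 bin_sub // leq_pmulr // bin_gt0.
Qed.

(** Legendre's formula: the exponent of p is the sum over k of floor(2m / p^k) - 2 floor(m / p^k),
    where each term is 0 or 1 and vanishes once p^k > 2m. *)
Lemma logn_bin_double (p m : nat) :
  prime p -> (0 < m)%N -> (p ^ logn p 'C(m + m, m) <= m + m)%N.
Proof.
move=> pr_p m_gt0.
have p_gt1 := prime_gt1 pr_p.
have logD : (logn p 'C(m + m, m) + (logn p m`! + logn p m`!) = logn p (m + m)`!)%N.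
  rewrite -!lognM ?muln_gt0 ?fact_gt0 ?bin_gt0 ?leq_addr //.
  by rewrite -(bin_fact (leq_addr m m)) addnK.
have logm : logn p m`! = (\sum_(1 <= k < (m + m).+1) m %/ p ^ k)%N.
  rewrite logn_fact // [RHS](@big_cat_nat _ _ _ m.+1) ?ltnS ?leq_addr //=.
  rewrite [X in (_ + X)%N]big_nat_cond [X in (_ + X)%N]big1 ?addn0 //.
  move=> k /andP[/andP[lt_mk _] _]; apply: divn_small.
  exact: leq_trans lt_mk (ltnW (ltn_expl _ _)).
have log_le : (logn p 'C(m + m, m) <= \sum_(1 <= k < (m + m).+1) (p ^ k <= m + m))%N.
  rewrite -(leq_add2r (logn p m`! + logn p m`!)) logD logm logn_fact //.
  rewrite -!big_split /=; apply: leq_sum => k _.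
  set q := (p ^ k)%N; have q_gt0 : (0 < q)%N by rewrite expn_gt0 ltnW.
  have := divn_eq m q; have := ltn_pmod m q_gt0.
  set a := (m %/ q)%N; set r := (m %% q)%N => lt_rq ->.
  have -> : (a * q + r + (a * q + r) = (a + a) * q + (r + r))%N by lia.
  rewrite divnMDl // addnC leq_add2r.
  case: (leqP q (r + r)) => [le_q|lt_q]; last by rewrite divn_small.
  rewrite (leq_trans le_q) ?leq_addl //=.
  by rewrite -ltnS ltn_divLR //; lia.
apply: leq_trans (trunc_logP p_gt1 _); last by rewrite addn_gt0 m_gt0.
rewrite leq_exp2l //; apply: leq_trans log_le _.
rewrite (@big_cat_nat _ _ _ (trunc_log p (m + m)).+1) //=; last first.
  rewrite ltnS -(leq_exp2l _ _ p_gt1).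
  apply: leq_trans (trunc_logP p_gt1 _) _; first by rewrite addn_gt0 m_gt0.
  exact: ltnW (ltn_expl _ _).
rewrite [X in (_ + X)%N]big_nat_cond [X in (_ + X)%N]big1 ?addn0; last first.
  move=> k /andP[/andP[lt_k _] _]; apply/eqP; rewrite eqb0 -ltnNge.
  apply: leq_trans (trunc_log_ltn _ p_gt1) _.
  by rewrite leq_exp2l.
apply: leq_trans (_ : (\sum_(1 <= k < (trunc_log p (m + m)).+1) 1 <= _)%N).
  by apply: leq_sum => k _; apply: leq_b1.
by rewrite sum_nat_const_nat subn1 muln1.
Qed.

(** A prime p <= r contributes at most 2m; a prime p > r has p^2 > 2m, so it divides the coefficient
    at most once and is absorbed by the primorial. *)
Lemma bin_leq_primorial (m r : nat) : (0 < m)%N -> (r <= m + m)%N -> (m + m <= r * r)%N ->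
  ('C(m + m, m) <= (m + m) ^ r * primorial (m + m))%N.
Proof.
move=> m_gt0 le_r le_rr.
have C_gt0 : (0 < 'C(m + m, m))%N by rewrite bin_gt0 leq_addr.
have log0 p : (m + m < p)%N -> logn p 'C(m + m, m) = 0%N.
  move=> lt_p; case pr_p: (prime p); last by rewrite lognE pr_p.
  apply/eqP; rewrite -leqn0 -ltnS -(ltn_exp2l _ _ (prime_gt1 pr_p)) expn1.
  exact: leq_ltn_trans (logn_bin_double pr_p m_gt0) lt_p.
rewrite -{1}(partnT C_gt0) (widen_partn _ (leq_addr (m + m) _)).
rewrite (@big_cat_nat _ _ _ (m + m).+1) ?ltnS ?leq_addl //=.
rewrite [X in (_ * X)%N]big_nat_cond [X in (_ * X)%N]big1 ?muln1; last first.
  by move=> p /andP[/andP[lt_p _] _]; rewrite log0.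
rewrite /primorial -(big_mkord prime id) [X in (_ * X)%N]big_mkcond /=.
(* One factor for each p with 0 < p <= r, prime or not, so that the two products compare
   termwise. *)
have -> : ((m + m) ^ r = \prod_(0 <= p < (m + m).+1) (if 0 < p <= r then m + m else 1))%N.
  rewrite (@big_cat_nat _ _ _ r.+1) ?ltnS //= [X in (_ * X)%N]big_nat_cond.
  rewrite [X in (_ * X)%N]big1 ?muln1; last first.
    by move=> p /andP[/andP[lt_p _] _]; rewrite (leqNgt p r) lt_p andbF.
  rewrite big_nat_recl //= mul1n big_nat_cond.
  rewrite (eq_bigr (fun=> (m + m)%N)); last by move=> p /andP[/andP[_ ->]].
  by rewrite -big_nat_cond prod_nat_const_nat subn0.
rewrite -big_split /= [X in (X <= _)%N]big_nat_cond [X in (_ <= X)%N]big_nat_cond.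
apply: leq_prod => p _.
case pr_p: (prime p); last by rewrite lognE pr_p muln1 expn0; case: ifP => //; lia.
rewrite (prime_gt0 pr_p) /=; have lep := logn_bin_double pr_p m_gt0.
case: (leqP p r) => [_|lt_rp]; first exact: leq_trans lep (leq_pmulr _ (prime_gt0 pr_p)).
rewrite mul1n -[X in (_ <= X)%N]expn1 leq_exp2l ?prime_gt1 //.
rewrite -ltnS -(ltn_exp2l _ _ (prime_gt1 pr_p)); apply: leq_ltn_trans lep _.
by apply: leq_ltn_trans le_rr _; rewrite -mulnn ltn_mul.
Qed.

(** At a power of 4, r can be the exact square root of 2m. After j is lowered by one, the loss
    (2m)^r is at most 2^(4^j) as soon as 4 (j + 1) <= 2^j, which holds for j >= 5. *)
Lemma primorial_exp4 (j : nat) : (6 <= j)%N -> (2 ^ (4 ^ j %/ 4) <= primorial (4 ^ j))%N.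
Proof.
move=> j_ge6; case: j j_ge6 => // j j_ge5.
set m := (2 * 4 ^ j)%N.
have m_gt0 : (0 < m)%N by rewrite muln_gt0 expn_gt0.
have mE : (m + m = 4 ^ j.+1)%N by rewrite expnS /m; lia.
have rE : (4 ^ j.+1 = 2 ^ j.+1 * 2 ^ j.+1)%N by rewrite -expnMn.
have r_gt0 : (0 < 2 ^ j.+1)%N by rewrite expn_gt0.
have := @bin_leq_primorial m (2 ^ j.+1) m_gt0.
rewrite mE rE leq_pmulr // leqnn => /(_ isT isT).
have := exp2_leq_bin m; rewrite mE rE => le1 le2.
have {le1 le2} le := leq_trans le1 le2.
have e4 : (m = 4 ^ j + 4 ^ j)%N by rewrite /m; lia.
rewrite -rE [X in (2 ^ (X %/ 4) <= _)%N]expnS mulKn // rE -(@leq_pmul2l (2 ^ (4 ^ j))) ?expn_gt0 //.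
rewrite -expnD -e4; apply: leq_trans le _; rewrite leq_pmul2r ?primorial_gt0 //.
rewrite -expnD -expnM leq_exp2l //.
have -> : (4 ^ j = 2 ^ j * 2 ^ j)%N by rewrite -expnMn.
rewrite expnS mulnA leq_pmul2r ?expn_gt0 //.
elim: j j_ge5 {m m_gt0 mE rE r_gt0 e4} => // j IH; rewrite ltnS leq_eqVlt.
by case/predU1P=> [<- //|/IH]; rewrite expnS; lia.
Qed.

(** The exponent is 64 = 4 * 4 * 4: one factor for n <= 4 M with M the half of n - 1, one for
    rounding M down to a power of 4, one from [primorial_exp4]. *)
Lemma primorial_expn (n : nat) : (2 * 4 ^ 6 + 1 <= n)%N ->
  (2 ^ n <= primorial (n.-1)./2 ^ 64)%N.
Proof.
move=> n_ge; set M := (n.-1)./2.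
have M_ge : (4 ^ 6 <= M)%N by rewrite /M; lia.
have M_gt0 : (0 < M)%N by apply: leq_trans M_ge.
set j := trunc_log 4 M.
have j_ge : (6 <= j)%N by rewrite trunc_log_max.
have le_jM : (4 ^ j <= M)%N by apply: trunc_logP.
have lt_Mj : (M < 4 ^ j.+1)%N by apply: trunc_log_ltn.
apply: leq_trans (_ : ((2 ^ (4 ^ j %/ 4)) ^ 64 <= _)%N).
  rewrite -expnM leq_exp2l //; move: j_ge lt_Mj; case: (j) => // i _.
  by rewrite !expnS mulKn //; rewrite /M; lia.
rewrite leq_exp2r //; apply: leq_trans (primorial_exp4 j_ge) _.
exact: leq_primorial.
Qed.

(** * Elementary symmetric polynomials in characteristic p *)

(** Since 2p - 1 - k >= p, the prime p divides (2p - 1 - k)!, but it divides neither (p - k)! nor (p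
    - 1)!. *)
Lemma dvdn_bin_carry (p k : nat) : prime p -> (0 < k < p)%N ->
  (p %| 'C(2 * p - 1 - k, p - k))%N.
Proof.
move=> pr_p /andP[k_gt0 lt_kp].
have b_gt0 : (0 < 'C(2 * p - 1 - k, p - k))%N by rewrite bin_gt0; lia.
have : (p %| (2 * p - 1 - k)`!)%N by rewrite dvdn_fact //; lia.
rewrite -(@bin_fact _ (p - k)); last by lia.
have nd m : (m < p)%N -> ~~ (p %| m`!)%N.
  elim: m => [|m IH] lt_m; first by rewrite fact0 dvdn1; lia.
  rewrite factS Euclid_dvdM // negb_or IH 1?ltnW // andbT.
  by apply/negP => /dvdn_leq; lia.
rewrite !Euclid_dvdM // (negPf (nd (p - k)%N _)); last by lia.
have -> : (2 * p - 1 - k - (p - k) = p.-1)%N by lia.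
by rewrite (negPf (nd p.-1 _)) ?orbF; last by lia.
Qed.

(** Vandermonde for 2p - 1 = p + (p - 1): p divides ['C(p, j)] for 0 < j < p, the term j = 0
    contains ['C(p - 1, p)] = 0, and j = p gives 1. *)
Lemma modn_bin_double_pred (p : nat) : prime p -> 'C(2 * p - 1, p) = 1 %[mod p].
Proof.
move=> pr_p; have p_gt0 := prime_gt0 pr_p.
have -> : (2 * p - 1 = p + (p - 1))%N by lia.
rewrite -binomial.Vandermonde big_ord_recr /= binn subnn bin0 -modnDml.
set s := (\sum_(j < p) _)%N; suff /eqP -> : (p %| s)%N by [].
apply: dvdn_sum => j _.
have [-> | j_gt0] := posnP j; first by rewrite subn0 [X in (_ * X)%N]bin_small ?muln0 //; lia.
by rewrite dvdn_mulr // prime_dvd_bin // j_gt0 /=.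
Qed.

Section ElementarySymmetric.
Variables (R : comNzRingType) (T : finType).
Implicit Types (u : T -> R) (A X J : {set T}).

Definition esym (k : nat) (A : {set T}) (u : T -> R) : R :=
  \sum_(X : {set T} | (X \subset A) && (#|X| == k)) \prod_(i in X) u i.

Lemma big_subsetU1 (x : T) A (F : {set T} -> R) : x \notin A ->
  \sum_(B : {set T} | B \subset x |: A) F B =
  \sum_(B : {set T} | B \subset A) (F (x |: B) + F B).
Proof.
move=> xA; rewrite (bigID (fun B : {set T} => x \in B)) big_split /=; congr (_ + _).
  rewrite [LHS](reindex_onto (fun B => x |: B) (fun B => B :\ x)) /=; last first.
    by move=> B /andP[_ xB]; rewrite setD1K.
  apply: eq_bigl => B; rewrite setU11 andbT; apply/andP/idP => [[]|sBA].
    move=> sB /eqP <-; apply/subsetP => y; rewrite !inE => /andP[/negPf yx].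
    by rewrite yx /= => yB; have := subsetP sB y; rewrite !inE yB yx orbT; apply.
  rewrite setUS //; split=> //; apply/eqP; apply: setU1K.
  by apply: contraNN xA; apply: (subsetP sBA).
apply: eq_bigl => B; apply/andP/idP => [[sB xB]|sBA].
  by rewrite -(setU1K xA) subsetD1 sB.
split; first exact: subset_trans sBA (subsetUr _ _).
by apply: contraNN xA; apply: (subsetP sBA).
Qed.

Lemma prod_shift X u (e : R) :
  \prod_(i in X) (u i + e) =
  \sum_(B : {set T} | B \subset X) e ^+ (#|X| - #|B|) * \prod_(i in B) u i.
Proof.
have [n] := ubnP #|X|; elim: n X => // n IH X lt_Xn.
have [->|[x xX]] := set_0Vmem X.
  rewrite big_set0 (eq_bigl (pred1 set0)); last by move=> B; rewrite subset0.
  by rewrite big_pred1_eq cards0 big_set0 mulr1.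
rewrite -(setD1K xX); have xY : x \notin X :\ x by rewrite setD11.
move: xY lt_Xn; rewrite (cardsD1 x) xX; move: (X :\ x) => Y xY lt_Yn.
rewrite big_setU1 //= IH // big_subsetU1 // mulr_sumr.
apply: eq_bigr => B sBY; have xB : x \notin B by apply: contraNN xY; apply: (subsetP sBY).
rewrite big_setU1 //= !cardsU1 xY xB /= !add1n subSS subSn ?subset_leq_card //.
rewrite exprS mulrDl mulrCA; congr (_ + _); exact: mulrA.
Qed.

Lemma esymU1 k x A u : x \notin A ->
  esym k.+1 (x |: A) u = u x * esym k A u + esym k.+1 A u.
Proof.
move=> xA; rewrite /esym !big_mkcondr /= big_subsetU1 // big_split mulr_sumr /=.
congr (_ + _); apply: eq_bigr => B sBA.
have xB : x \notin B by apply: contraNN xA; apply: (subsetP sBA).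
by rewrite big_setU1 // cardsU1 xB add1n eqSS; case: ifP; rewrite ?mulr0.
Qed.

Lemma eq_esym k A u v : {in A, u =1 v} -> esym k A u = esym k A v.
Proof.
move=> uv; apply: eq_bigr => X /andP[sXA _]; apply: eq_bigr => i iX.
by rewrite uv ?(subsetP sXA).
Qed.

Lemma card_supersets (A B : {set T}) k : B \subset A -> (#|B| <= k)%N ->
  #|[set X : {set T} | [&& B \subset X, X \subset A & #|X| == k]]| =
  'C(#|A| - #|B|, k - #|B|).
Proof.
move=> sBA le_Bk; have sE : (#|A| - #|B| = #|A :\: B|)%N.
  by rewrite cardsD (setIidPr sBA).
rewrite sE -cards_draws.
have inj : {in [set X : {set T} | X \subset A :\: B & #|X| == (k - #|B|)%N] &,
    injective (setU B)}.
  move=> X Y; rewrite !inE !subsetD => /andP[/andP[_ dX] _] /andP[/andP[_ dY] _].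
  move=> /(congr1 (fun Z : {set T} => Z :\: B)); rewrite !setDUl !setDv !set0U.
  by rewrite (setDidPl dX) (setDidPl dY).
rewrite -(card_in_imset inj); apply: eq_card => X; rewrite inE.
apply/and3P/imsetP => [[sBX sXA /eqP kX]|[Y]].
  exists (X :\: B); last by rewrite setDE setUIr setUCr setIT (setUidPr sBX).
  by rewrite inE setSD //= cardsD (setIidPr sBX) kX.
rewrite inE subsetD => /andP[/andP[sYA dY] /eqP kY] ->.
rewrite subsetUl subUset sBA sYA; split=> //.
rewrite cardsU kY; move: dY; rewrite -setI_eq0 setIC => /eqP ->.
by rewrite cards0 subn0 subnKC.
Qed.

(* In characteristic p only the subsets of size 0 and p contribute to the
   expansion, the other binomial coefficients being divisible by p. *)
Lemma esym_shift (p : nat) (J : {set T}) u (e : R) :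
  p \in [pchar R] -> #|J| = (2 * p - 1)%N ->
  esym p J (fun i => u i + e) = esym p J u + e ^+ p.
Proof.
move=> charRp cJ; have pr_p := pcharf_prime charRp.
have p_gt0 := prime_gt0 pr_p.
rewrite /esym; under eq_bigr do rewrite prod_shift.
rewrite (exchange_big_dep (fun B : {set T} => (B \subset J) && (#|B| <= p)%N)) /=; last first.
  move=> X B /andP[sXJ /eqP <-] sBX.
  by rewrite (subset_trans sBX sXJ) subset_leq_card.
(* A set B arises once for each p-element X between B and J. *)
rewrite (eq_bigr (fun B : {set T} => (e ^+ (p - #|B|) * \prod_(i in B) u i)
    *+ 'C(2 * p - 1 - #|B|, p - #|B|))); last first.
  move=> B /andP[sBJ le_Bp]; rewrite -cJ -card_supersets // -sumr_const.
  by apply: eq_big => [X|X /andP[/andP[_ /eqP ->] _]]; rewrite ?inE // andbC.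
rewrite (bigID (fun B : {set T} => #|B| == p)) /=; congr (_ + _).
  apply: eq_big => [B|B /andP[_ /eqP cB]].
    by case: eqP => [->|]; rewrite ?leqnn ?andbT ?andbF.
  by rewrite cB subnn mul1r bin0.
rewrite (bigD1 set0) /=; last by rewrite sub0set cards0 eq_sym -lt0n p_gt0.
rewrite cards0 !subn0 big_set0 mulr1 big1 ?addr0 => [|B].
  by rewrite -mulr_natr -(GRing.natr_mod_pchar charRp) modn_bin_double_pred // GRing.natr_mod_pchar // mulr1.
case/andP=> /andP[/andP[_ le_Bp] ne_Bp]; rewrite -cards_eq0 -lt0n => B_gt0.
have /dvdnP[c ->] : (p %| 'C(2 * p - 1 - #|B|, p - #|B|))%N.
  by rewrite dvdn_bin_carry // B_gt0 ltn_neqAle ne_Bp.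
by rewrite mulrnA (mulrn_pchar charRp).
Qed.
End ElementarySymmetric.

(** * The potentials on holonomies *)

Section Potential.
Variables (R : comNzRingType) (p : nat) (V : finType) (q j0 : V) (J : {set V}).
Variable m : {set V} -> V.
Hypotheses (charRp : p \in [pchar R]) (cardJ : #|J| = (2 * p - 1)%N).
Hypotheses (qJ : q \notin J) (j0J : j0 \in J).
Hypothesis mP : forall X : {set V}, X \subset J -> #|X| = p.-1 -> m X \in J :\: X.
Implicit Types (y : V -> V -> R) (e : R).

(* The coefficients are antisymmetric in (j, k) and, J :\: X having p elements,
   sum to 1 over k in J :\: X for every j in J :\: X. *)
Definition flow (X : {set V}) (j k : V) : R := (k == m X)%:R - (j == m X)%:R.

(** An edge from q to j acts through [y q j], with the same slope as on [esym p J]. The flow terms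
    compensate a change of the edge from o to j, and their antisymmetry makes the values at j and k
    move together when the edge from j to k changes. *)
Definition potential_in y (j : V) : R :=
  \sum_(X : {set V} | (X \subset J :\ j) && (#|X| == p.-1))
    (\prod_(i in X) y q i) * (y q j + \sum_(k in J :\: X) flow X j k * y j k).

Definition potential y (v : V) : R :=
  if v == q then esym p J (y q) - y q j0 else if v \in J then potential_in y v else 0.

Lemma potential_q y : potential y q = esym p J (y q) - y q j0.
Proof. by rewrite /potential eqxx. Qed.

Lemma potential_J y j : j \in J -> potential y j = potential_in y j.
Proof.
by move=> jJ; rewrite /potential jJ; case: eqP qJ => // <-; rewrite jJ.
Qed.

Lemma potential_out y v : v != q -> v \notin J -> potential y v = 0.
Proof. by rewrite /potential => /negPf -> /negPf ->. Qed.

(** As [J :\: X] has (2p - 1) - (p - 1) = p elements, the part of [flow] that does not depend on k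
    sums to 0 in characteristic p; the other part is 1 at k = [m X] only. *)
Lemma sum_flow (X : {set V}) (j : V) : X \subset J :\ j -> #|X| = p.-1 -> j \in J ->
  \sum_(k in J :\: X) flow X j k = 1.
Proof.
move=> sX cX jJ; have [sXJ jX] := subsetD1P sX.
rewrite sumrB sumr_const.
have -> : #|J :\: X| = p.
  rewrite cardsD (setIidPr sXJ) cardJ cX.
  by have := prime_gt0 (pcharf_prime charRp); lia.
rewrite (mulrn_pchar charRp) subr0 (bigD1 (m X)) ?mP //= eqxx big1 ?addr0 //.
by move=> k /andP[_ /negPf ->].
Qed.

Lemma eq_potential y y' v : {in J, y q =1 y' q} -> {in J, y v =1 y' v} ->
  potential y v = potential y' v.
Proof.
move=> eq_q eq_v; rewrite /potential; case: eqP => _.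
  by rewrite (eq_esym _ eq_q) eq_q.
case: ifP => // vJ; apply: eq_bigr => X /andP[/subsetD1P[sXJ _] _].
congr (_ * (_ + _)); last 1 first.
- by apply: eq_bigr => k /setDP[kJ _]; rewrite eq_v.
- by apply: eq_bigr => i iX; rewrite eq_q ?(subsetP sXJ).
by rewrite eq_q.
Qed.

(** Both [esym p J] and the value at j are affine in [y q j] with the same slope
    [esym p.-1 (J :\ j)]; the difference moves only through the summand [- y q j0] at q. *)
Lemma potential_step_qj y y' j e : j \in J ->
  (forall k, y' q k = y q k + e * (k == j)%:R) -> {in J, y' j =1 y j} ->
  potential y' j - potential y' q = potential y j - potential y q + e * (j == j0)%:R.
Proof.
move=> jJ eq_q eq_j.
have esJ (z : V -> V -> R) : esym p J (z q) =
    z q j * esym p.-1 (J :\ j) (z q) + esym p (J :\ j) (z q).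
  by rewrite -(prednK (prime_gt0 (pcharf_prime charRp))) -{1}(setD1K jJ) esymU1 ?setD11.
have eqJj k : esym k (J :\ j) (y' q) = esym k (J :\ j) (y q).
  by apply: eq_esym => i; rewrite !inE eq_q => /andP[/negPf ->]; rewrite mulr0 addr0.
have in_j : potential_in y' j = potential_in y j + e * esym p.-1 (J :\ j) (y q).
  rewrite -eqJj mulr_sumr -big_split; apply: eq_bigr => X /andP[/subsetD1P[sXJ jX] _] /=.
  have -> : \sum_(k in J :\: X) flow X j k * y' j k = \sum_(k in J :\: X) flow X j k * y j k.
    by apply: eq_bigr => k /setDP[kJ _]; rewrite eq_j.
  have <- : \prod_(i in X) y' q i = \prod_(i in X) y q i.
    apply: eq_bigr => i iX; rewrite eq_q; case: eqP iX jX => [-> ->|] //.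
    by rewrite mulr0 addr0.
  by rewrite eq_q eqxx /=; ring.
rewrite !potential_q !potential_J // in_j !esJ !eqJj !eq_q eqxx [j0 == j]eq_sym /=; ring.
Qed.

(** Only the sets X avoiding both j and k see the edge, and for these the antisymmetry of [flow]
    meets the opposite signs of the two increments. *)
Lemma potential_step_jk y y' j k e : j \in J -> k \in J -> j != k ->
  {in J, y' q =1 y q} ->
  (forall l, y' j l = y j l + e * (l == k)%:R) ->
  (forall l, y' k l = y k l - e * (l == j)%:R) ->
  potential y' k - potential y' j = potential y k - potential y j.
Proof.
move=> jJ kJ ne_jk eq_q eq_j eq_k.
have change (a b : V) (c : R) : a \in J -> b \in J -> 
  (forall l, y' a l = y a l + c * (l == b)%:R) ->
  potential_in y' a = potential_in y a + c *
    \sum_(X : {set V} | [&& X \subset J, a \notin X, b \notin X & #|X| == p.-1])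
      (\prod_(i in X) y q i) * flow X a b.
  move=> aJ bJ eq_a; rewrite mulr_sumr.
  rewrite [X in _ = _ + X](eq_bigl (fun X : {set V} =>
    ((X \subset J :\ a) && (#|X| == p.-1)) && (b \notin X))); last first.
    by move=> X; rewrite subsetD1 -!andbA; congr [&& _, _ & _]; exact: andbC.
  rewrite [X in _ = _ + X]big_mkcondr -big_split.
  apply: eq_bigr => X /andP[/subsetD1P[sXJ aX] _] /=.
  have -> : \prod_(i in X) y' q i = \prod_(i in X) y q i.
    by apply: eq_bigr => i iX; rewrite eq_q ?(subsetP sXJ).
  have -> : \sum_(l in J :\: X) flow X a l * y' a l =
      \sum_(l in J :\: X) flow X a l * y a l + (if b \notin X then flow X a b * c else 0).
    under eq_bigr do rewrite eq_a mulrDr.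
    rewrite big_split /=; congr (_ + _); case: ifPn => [bX|].
      rewrite (bigD1 b) ?inE ?bX //= eqxx mulr1 big1 ?addr0 // => l /andP[_ /negPf ->].
      by rewrite !mulr0.
    rewrite negbK => bX; apply: big1 => l /setDP[_ lX].
    by case: eqP lX bX => [-> /negPf->|]; rewrite ?mulr0.
  by rewrite eq_q //; case: ifP => _; ring.
rewrite !potential_J // (change j k e) // (change k j (- e)) //; last first.
  by move=> l; rewrite eq_k mulNr.
rewrite (eq_bigr (fun X : {set V} => - (\prod_(i in X) y q i * flow X j k))).
  rewrite (eq_bigl (fun X : {set V} => [&& X \subset J, j \notin X, k \notin X & #|X| == p.-1])).
    by rewrite sumrN; ring.
  by move=> X; congr (_ && _); rewrite andbCA.
by move=> X _; rewrite /flow; ring.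
Qed.

Lemma potential_step_oq y y' e : e ^+ p = e ->
  {in J, forall k, y' q k = y q k + e} -> potential y' q = potential y q.
Proof.
move=> ep eq_q; rewrite !potential_q (@eq_esym _ _ _ _ _ (fun k => y q k + e) eq_q).
rewrite esym_shift // ep eq_q //; ring.
Qed.

(** The loss e of [y q j] is made up by the gains of the [y j k], whose weights add up to 1 by
    [sum_flow]. *)
Lemma potential_step_oj y y' j e : j \in J ->
  (forall k, k != j -> y' q k = y q k) -> y' q j = y q j - e ->
  {in J, forall k, y' j k = y j k + e * (k != j)%:R} ->
  potential y' j = potential y j.
Proof.
move=> jJ eq_q eq_qj eq_j; rewrite !potential_J //.
apply: eq_bigr => X /andP[sXJj /eqP cX]; have [sXJ jX] := subsetD1P sXJj.
congr (_ * _).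
  by apply: eq_bigr => i iX; apply: eq_q; apply: contraNneq jX => <-.
rewrite eq_qj [X in _ + X](eq_bigr (fun k => flow X j k * y j k + flow X j k * e)).
  by rewrite big_split -mulr_suml sum_flow //=; ring.
move=> k /setDP[kJ _]; rewrite eq_j // mulrDr; congr (_ + _).
(* For k = j the holonomy gains nothing, but the weight [flow X j j] is 0. *)
by case: eqP => [->|_]; rewrite /flow ?subrr ?mul0r // mulr1.
Qed.

(* The increment of y is that of the holonomies y i j of the loops o -> i -> j -> o
   when the edge x -> x' is increased by e. *)
Lemma potential_step (o x x' : V) y y' e :
  o \notin J -> o != q -> x != x' -> x' != o -> e ^+ p = e ->
  (forall i j, y' i j = y i j + e * (((o == x) && (i == x'))%:R + ((i == x) && (j == x'))%:R
     - ((i == x') && (j == x))%:R - ((o == x) && (j == x'))%:R)) ->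
  potential y' x' - potential y' x = potential y x' - potential y x
    + e * (((x == q) && (x' == j0))%:R + ((x == j0) && (x' == q))%:R).
Proof.
move=> oJ oq xx' x'o ep dy.
have neq z w : z \in J -> w \notin J -> ((z == w) = false) * ((w == z) = false).
  by move=> zJ wJ; have nzw : z != w by [apply: contraNneq wJ => <-]; rewrite [w == z]eq_sym (negPf nzw).
have [xo|xo] := eqVneq x o.
  rewrite {x}xo in xx' dy *; rewrite eqxx /= in dy.
  rewrite !(potential_out _ oq) // (negPf oq) !(neq j0 o) //= addr0 mulr0 addr0 !subr0.
  have [x'q|x'q] := eqVneq x' q.
    rewrite x'q in dy *; apply: (@potential_step_oq _ _ e) => // k kJ.
    by rewrite dy eqxx [q == o]eq_sym (negPf oq) !(neq k q) // !(neq k o) //=; ring.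
  have [x'J|x'J] := boolP (x' \in J); last by rewrite !potential_out.
  apply: (@potential_step_oj _ _ _ e) => // [k kx'||k kJ].
  - by rewrite dy [q == o]eq_sym (negPf oq) [q == x']eq_sym (negPf x'q) (negPf kx') /=; ring.
  - by rewrite dy [q == o]eq_sym (negPf oq) [q == x']eq_sym (negPf x'q) eqxx /=; ring.
  by rewrite dy !(neq k o) // eqxx (negPf x'o); case: (k == x') => /=; ring.
have {}dy i j : y' i j = y i j + e * (((i == x) && (j == x'))%:R - ((i == x') && (j == x))%:R).
  by rewrite dy [o == x]eq_sym (negPf xo) /=; ring.
have x'x : x' == x = false by rewrite eq_sym (negPf xx').
(* An endpoint z outside q and J has potential 0, and the potential at the other endpoint w reads no
   holonomy affected by the edge between them. *)
have away z w : z != q -> z \notin J -> w != z ->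
    (forall i, i != z -> w != z -> y' w i = y w i) -> (forall i, i != z -> y' q i = y q i) ->
    (potential y' z = potential y z) * (potential y' w = potential y w).
  move=> zq zJ wz dw dq; rewrite !(potential_out _ zq zJ); split=> //.
  apply: eq_potential => i iJ; [rewrite dq // | rewrite dw //];
    by apply: contraNneq zJ => <-.
have [/andP[x'q x'J]|x'in] := boolP ((x' != q) && (x' \notin J)).
  have [-> ->] : (potential y' x' = potential y x') * (potential y' x = potential y x).
    apply: away => // [i ix' _|i ix'].
      by rewrite dy (negPf xx') (negPf ix') andbF /=; ring.
    by rewrite dy [q == x']eq_sym (negPf x'q) (negPf ix') andbF /=; ring.
  by rewrite (negPf x'q) [x' == j0]eq_sym !(neq j0 x') // !andbF /=; ring.
have [/andP[xq xJ]|xin] := boolP ((x != q) && (x \notin J)).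
  have [-> ->] : (potential y' x = potential y x) * (potential y' x' = potential y x').
    apply: away => // [|i ix _|i ix]; first by rewrite x'x.
      by rewrite dy x'x (negPf ix) andbF /=; ring.
    by rewrite dy [q == x]eq_sym (negPf xq) (negPf ix) andbF /=; ring.
  by rewrite (negPf xq) [x == j0]eq_sym !(neq j0 x) //=; ring.
(* From here on, each endpoint is q or lies in J. *)
move: x'in xin; rewrite !negb_and !negbK.
have [xq|xq] := eqVneq x q.
  rewrite {x}xq in dy xx' x'x xo *; rewrite x'x /= => x'J _.
  rewrite !(neq j0 q) // (@potential_step_qj y y' x' e) //=; first by ring.
    by move=> k; rewrite dy eqxx [q == x']eq_sym x'x /=; ring.
  by move=> k kJ; rewrite dy x'x !(neq k q) // andbF /=; ring.
have [x'q _ /= xJ|x'q /= x'J xJ] := eqVneq x' q.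
  rewrite {x'}x'q in dy xx' x'x x'o *.
  rewrite -[LHS]opprB (@potential_step_qj y y' x (- e)) // ?andbT /=; first by ring.
    by move=> k; rewrite dy eqxx x'x /=; ring.
  by move=> k kJ; rewrite dy (negPf xx') !(neq k q) // andbF /=; ring.
rewrite (@potential_step_jk y y' x x' e) //; first by rewrite andbF /=; ring.
- by move=> k kJ; rewrite dy [q == x]eq_sym [q == x']eq_sym (negPf xq) (negPf x'q) /=; ring.
- by move=> k; rewrite dy eqxx (negPf xx') /=; ring.
- by move=> k; rewrite dy eqxx x'x /=; ring.
Qed.

End Potential.

(** * Solutions in the Albanese graph *)

Section Quotient.
Local Open Scope quotient_scope.
Variables (p : nat) (S : finType) (U : {vspace {ffun S -> ('F_p)^o}}).
Local Notation W := (quot_space U).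
Local Notation V := {ffun S -> ('F_p)^o}.

Lemma eq_pi_quot (a b : V) : (\pi_W a = \pi_W b) <-> (a - b \in U).
Proof.
split=> [/eqP|ab]; first by rewrite Quotient.idealrBE.
by apply/eqP; rewrite -[_ == _]Quotient.idealrBE.
Qed.

Lemma pi_quotD (a b : V) : \pi_W (a + b) = \pi_W a + \pi_W b.
Proof. exact: (raddfD \pi_W). Qed.

(** The representative of a sum is determined only up to U, which F does not see. *)
Lemma color_dir_repr (T : Type) (F : V -> T) (w : W) (s : S) :
  (forall a u, u \in U -> F (a + u) = F a) ->
  F (repr (w + color_dir U s)) = F (repr w + basis_vec p s).
Proof.
move=> FU; rewrite -(subrK (repr w + basis_vec p s) (repr (w + _))) addrC FU //.
by apply/eq_pi_quot; rewrite reprK pi_quotD reprK.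
Qed.

Lemma boundaryE (a : chain1 U) (w : W) :
  boundary a w =
  \sum_e (a e : 'F_p) * ((w == e.1 + color_dir U e.2)%:R - (w == e.1)%:R).
Proof. by rewrite /boundary sum_ffunE; apply: eq_bigr => e _; rewrite !ffunE. Qed.

Lemma boundary_sumZ (I : finType) (c : I -> ('F_p)^o) (a : I -> chain1 U) (w : W) :
  boundary (\sum_i c i *: a i) w = \sum_i (c i : 'F_p) * boundary (a i) w.
Proof.
rewrite [LHS]boundaryE.
transitivity (\sum_e \sum_i (c i : 'F_p) * ((a i e : 'F_p) *
    ((w == e.1 + color_dir U e.2)%:R - (w == e.1)%:R))).
  apply: eq_bigr => e _; rewrite sum_ffunE mulr_suml.
  by apply: eq_bigr => i _; rewrite ffunE -mulrA.
rewrite exchange_big; apply: eq_bigr => i _ /=.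
by rewrite boundaryE mulr_sumr.
Qed.

(** Summation by parts: the transpose of [boundary] sends a function on the vertices to its
    increments along the edges. *)
Lemma pair_boundary (phi : W -> 'F_p) (a : chain1 U) :
  \sum_w boundary a w * phi w =
  \sum_e (a e : 'F_p) * (phi (e.1 + color_dir U e.2) - phi e.1).
Proof.
under eq_bigr do rewrite boundaryE mulr_suml.
rewrite exchange_big /=; apply: eq_bigr => e _.
have pick w0 : \sum_w (w == w0)%:R * phi w = phi w0.
  by rewrite (bigD1 w0) //= eqxx mul1r big1 ?addr0 // => w /negPf ->; rewrite mul0r.
rewrite -!pick -sumrB mulr_sumr; apply: eq_bigr => w _.
by rewrite -mulrBl mulrA.
Qed.

End Quotient.

Section Graph.
Variables (p : nat) (K : ograph).
Local Notation E := (edge K).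

Lemma coboundaryE (v : vertex K) (s : E) :
  coboundary p v s = (target s == v)%:R - (source s == v)%:R.
Proof.
have sum_at (P : pred E) : \sum_(r | P r) basis_vec p r s = (P s)%:R.
  rewrite big_mkcond (bigD1 s) //= ffunE eqxx big1 ?addr0 => [|r /negPf nr].
    by case: (P s).
  by rewrite ffunE [s == r]eq_sym nr /= if_same.
by rewrite !ffunE !sum_ffunE !sum_at.
Qed.

Lemma sum_basis_vec (c : E -> ('F_p)^o) : \sum_s c s *: basis_vec p s = [ffun s => c s].
Proof.
apply/ffunP => s; rewrite sum_ffunE ffunE.
transitivity (\sum_t (c t : 'F_p) * (s == t)%:R).
  by apply: eq_bigr => t _; rewrite !ffunE.
rewrite (bigD1 s) //= eqxx mulr1 big1 ?addr0 // => t /negPf nt.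
by rewrite eq_sym nt mulr0.
Qed.

Lemma coboundary_B1 (v : vertex K) : coboundary p v \in B1 p K.
Proof. by apply: memv_span; apply: map_f; rewrite mem_enum. Qed.

Lemma B1_coboundaries (u : {ffun E -> ('F_p)^o}) : u \in B1 p K ->
  exists phi : vertex K -> 'F_p,
    forall s, u s = \sum_v phi v * (coboundary p v s : 'F_p).
Proof.
move=> uB; exists (fun v => coord (image_tuple (@coboundary p K) (vertex K)) (enum_rank v) u) => s.
rewrite {1}(coord_span uB) sum_ffunE (reindex (@enum_rank (vertex K))) /=; last first.
  exact: onW_bij (@enum_rank_bij _).
by apply: eq_bigr => v _; rewrite ffunE nth_image enum_rankK.
Qed.

Lemma solution_profile_sum (b : E -> chain1 (B1 p K))
    (Q : vertex K -> {ffun E -> ('F_p)^o} -> 'F_p) (t : E -> 'F_p) :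
  is_solution b ->
  (forall v a u, u \in B1 p K -> Q v (a + u) = Q v a) ->
  (forall a s, Q (target s) (a + basis_vec p s) - Q (source s) (a + basis_vec p s) =
     Q (target s) a - Q (source s) a + t s) ->
  \sum_s t s * color_profile b s = 0.
Proof.
move=> [bc bU] QU Qt.
pose phi v (w : quot_space (B1 p K)) : ('F_p)^o := Q v (repr w).
have pair0 v : \sum_w boundary (\sum_s coboundary p v s *: b s) w * phi v w = 0.
  rewrite bU ?sum_basis_vec; first by apply: big1 => w _; rewrite ffunE mul0r.
  rewrite (_ : [ffun s => _] = coboundary p v) ?coboundary_B1 //.
  by apply/ffunP => s; rewrite ffunE.
have : \sum_v \sum_w boundary (\sum_s coboundary p v s *: b s) w * phi v w = 0.
  by apply: big1 => v _.
under eq_bigr do rewrite pair_boundary.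
(* The edge of color s at w pairs only with the functions attached to the two endpoints of s, with
   signs +1 and -1, so its total weight is the increment [t s]. *)
rewrite exchange_big /= (eq_bigr (fun e => b e.2 (e.1, e.2) * t e.2)); last first.
  move=> [w s] _ /=; transitivity (b s (w, s) *
     \sum_v (coboundary p v s * (phi v (w + color_dir (B1 p K) s) - phi v w))).
    rewrite mulr_sumr; apply: eq_bigr => v _; rewrite mulrA; congr (_ * _).
    rewrite sum_ffunE (bigD1 s) //= big1 ?addr0 => [|r nr]; first by rewrite [RHS]mulrC ffunE.
    by rewrite !ffunE bc 1?eq_sym // scaler0.
  congr (_ * _); have sel x (X : vertex K -> 'F_p) : \sum_v (x == v)%:R * X v = X x.
    rewrite (bigD1 x) //= eqxx mul1r big1 ?addr0 // => v /negPf nv.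
    by rewrite eq_sym nv mul0r.
  under eq_bigr do rewrite coboundaryE mulrBl.
  rewrite sumrB !sel /phi !color_dir_repr //; do ?exact: QU.
  by rewrite opprD opprK addrACA Qt [- _ + Q _ _]addrC -[Q (source s) _ - _]opprB addrAC subrr add0r.
rewrite -(pair_bigA _ (fun w s => b s (w, s) * t s)) /= exchange_big /=.
move=> sum0; rewrite -[RHS]sum0; apply: eq_bigr => s _; rewrite ffunE mulr_sumr.
by apply: eq_bigr => w _; rewrite mulrC.
Qed.

End Graph.

(** * Small primes are radical *)

Definition arrow (K : ograph) (s : edge K) (i j : vertex K) : bool :=
  (source s == i) && (target s == j).

Lemma set2_eqE (T : finType) (a b i j : T) :
  ([set a; b] == [set i; j]) = ((a == i) && (b == j)) || ((a == j) && (b == i)).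
Proof.
apply/eqP/orP => [eq_set|[]/andP[/eqP-> /eqP->] //]; last by rewrite setUC.
have /set2P ai : a \in [set i; j] by rewrite -eq_set set21.
have /set2P bi : b \in [set i; j] by rewrite -eq_set set22.
have /set2P ia : i \in [set a; b] by rewrite eq_set set21.
have /set2P ja : j \in [set a; b] by rewrite eq_set set22.
by case: ai => ?; case: bi => ?; case: ia => ?; case: ja => ?; subst;
  rewrite ?eqxx; auto.
Qed.

Section Complete.
Variables (n : nat) (K : ograph).
Hypothesis complK : is_complete_graph n K.
Local Notation E := (edge K).
Local Notation V := (vertex K).

Lemma edge_neq (s : E) : source s != target s.
Proof. by case: complK. Qed.

Lemma sum_arrow (R : pzSemiRingType) (i j : V) : i != j ->
  \sum_(s : E) ((arrow s i j)%:R + (arrow s j i)%:R) = 1 :> R.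
Proof.
move=> ij; case: complK => _ _ /(_ i j ij) [s0 [/eqP s0E s0U]].
have arrowE s : (arrow s i j)%:R + (arrow s j i)%:R = (s == s0)%:R :> R.
  have -> : (s == s0) = (arrow s i j) || (arrow s j i).
    rewrite /arrow -set2_eqE; apply/eqP/eqP => [->|/s0U //]; exact/eqP.
  case: (boolP (arrow s i j)) => [/andP[/eqP a _]|_]; last by rewrite add0r.
  by rewrite /arrow a (negPf ij) /= addr0.
under eq_bigr do rewrite arrowE.
by rewrite (bigD1 s0) //= eqxx big1 ?addr0 // => s /negPf ->.
Qed.

Section Holonomy.
Variable p : nat.
Local Notation C1 := {ffun E -> ('F_p)^o}.

(** A cochain is read as an F_p-valued connection; the difference makes it antisymmetric in i and j,
    whatever orientation the edge carries. *)
Definition transport (a : C1) (i j : V) : 'F_p :=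
  \sum_s a s * ((arrow s i j)%:R - (arrow s j i)%:R).

Definition holonomy (o : V) (a : C1) (i j : V) : 'F_p :=
  transport a o i + transport a i j - transport a o j.

Lemma transportD a b i j : transport (a + b) i j = transport a i j + transport b i j.
Proof. by rewrite -big_split; apply: eq_bigr => s _; rewrite ffunE mulrDl. Qed.

Lemma transport_basis s i j :
  transport (basis_vec p s) i j = (arrow s i j)%:R - (arrow s j i)%:R.
Proof.
rewrite /transport (bigD1 s) //= ffunE eqxx mul1r big1 ?addr0 // => r /negPf nr.
by rewrite ffunE nr mul0r.
Qed.

Lemma transport_coboundary v i j :
  transport (coboundary p v) i j = (j == v)%:R - (i == v)%:R.
Proof.
have [->|ij] := eqVneq i j.
  by rewrite subrr /transport big1 // => s _; rewrite subrr mulr0.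
rewrite -[RHS]mulr1 -[X in _ = _ * X](sum_arrow _ ij) mulr_sumr; apply: eq_bigr => s _.
rewrite coboundaryE mulrBr mulrDr; congr (_ + _).
  by case: (boolP (arrow s i j)) => [/andP[/eqP-> /eqP->]|_]; rewrite ?mulr0.
case: (boolP (arrow s j i)) => [/andP[/eqP-> /eqP->]|_]; last by rewrite !mulr0 oppr0.
by rewrite !mulr1 opprB.
Qed.

Lemma holonomyD o a b i j : holonomy o (a + b) i j = holonomy o a i j + holonomy o b i j.
Proof. by rewrite /holonomy !transportD; ring. Qed.

(** A coboundary is a gauge change: it alters the transport from k to l by phi l - phi k, which
    telescopes around the loop o -> i -> j -> o. *)
Lemma holonomy_B1 o a u i j : u \in B1 p K -> holonomy o (a + u) i j = holonomy o a i j.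
Proof.
move=> uB; rewrite holonomyD -[RHS]addr0; congr (_ + _).
have [phi uE] := B1_coboundaries uB.
have transport_u k l : transport u k l =
    \sum_v phi v * ((l == v)%:R - (k == v)%:R).
  rewrite /transport; under eq_bigr do rewrite uE mulr_suml.
  rewrite exchange_big; apply: eq_bigr => v _ /=.
  by rewrite -transport_coboundary mulr_sumr; apply: eq_bigr => s _; rewrite mulrA.
rewrite /holonomy !transport_u -big_split -sumrB big1 // => v _ /=; ring.
Qed.

Lemma holonomy_basis o a s i j : let x := source s in let x' := target s in
  holonomy o (a + basis_vec p s) i j - holonomy o a i j =
  ((o == x) && (i == x'))%:R + ((i == x) && (j == x'))%:R - ((i == x') && (j == x))%:R
  - ((o == x) && (j == x'))%:R - ((o == x') && (i == x))%:R + ((o == x') && (j == x))%:R.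
Proof.
rewrite /= holonomyD {2}/holonomy !transport_basis /arrow.
rewrite ![source s == _]eq_sym ![target s == _]eq_sym ![(_ == target s) && _]andbC.
ring.
Qed.

End Holonomy.

Lemma radical_prime_complete (p : nat) :
  prime p -> (2 * p + 1 <= n)%N -> radical_prime K p.
Proof.
move=> pr_p le_pn; split=> // b bsol [c bc].
have p_gt1 := prime_gt1 pr_p; have charp := pchar_Fp pr_p.
have cardV : #|V| = n by case: complK.
have fermat (e : 'F_p) : e ^+ p = e by rewrite -{2}(expf_card e) card_Fp.
(* Besides o and q, at least (2p + 1) - 2 = 2p - 1 vertices remain for J. *)
have [o [q [r enumE]]] : exists o q r, enum V = [:: o, q & r].
  have: (2 <= size (enum V))%N by rewrite -cardE cardV; lia.
  by case: (enum V) => [|o [|q r]] //; exists o, q, r.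
have := enum_uniq V; rewrite enumE /= inE negb_or -andbA.
case/and4P=> oq o_r q_r r_uniq.
have size_r : (2 * p - 1 <= size r)%N.
  by have := cardV; rewrite cardE enumE /=; lia.
pose J := [set x in take (2 * p - 1) r].
have cardJ : #|J| = (2 * p - 1)%N.
  by rewrite cardsE (card_uniqP _) ?take_uniq // size_takel.
have oJ : o \notin J by rewrite inE; apply: contra o_r; apply: mem_take.
have qJ : q \notin J by rewrite inE; apply: contra q_r; apply: mem_take.
have [j0 j0J] : exists j0, j0 \in J by apply/set0Pn; rewrite -cards_eq0 cardJ; lia.
(* For X in J with p - 1 elements, [J :\: X] has p elements, so [pick] succeeds and the default [q]
   is not returned. *)
pose m X := odflt q [pick k in J :\: X].
have mP (X : {set V}) : X \subset J -> #|X| = p.-1 -> m X \in J :\: X.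
  move=> sXJ cX; rewrite /m; case: pickP => // JX0.
  have := cardsD J X; rewrite (eq_card0 JX0) (setIidPr sXJ) cardJ cX.
  by clear -p_gt1; lia.
pose Q v (a : {ffun E -> ('F_p)^o}) := potential p q j0 J m (holonomy o a) v.
have eq_hol v y y' : y =2 y' -> potential p q j0 J m y v = potential p q j0 J m y' v.
  by move=> yy'; apply: eq_potential => // i _; apply: yy'.
(* The indicator of the edge joining q and j0: its pairing with a constant profile is that
   constant. *)
pose t (s : E) : 'F_p := (arrow s q j0)%:R + (arrow s j0 q)%:R.
have sum_t : \sum_s t s = 1 by apply: sum_arrow; apply: contraNneq qJ => ->.
have /= := @solution_profile_sum p K b Q t bsol.
have -> : \sum_s t s * color_profile b s = c.
  by under eq_bigr do rewrite bc; rewrite -mulr_suml sum_t mul1r.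
move=> c0; apply/ffunP => s; rewrite bc ffunE c0 {s} // => [v a u uB|a s].
  by apply: eq_hol => i j; apply: holonomy_B1.
have := holonomy_basis o a s; rewrite /= /Q /t /arrow; have := edge_neq s.
move: (holonomy o (a + _)) (holonomy o a) (source s) (target s) => y' y x x' xx' dy.
have step := @potential_step _ p V q j0 J m charp cardJ qJ j0J mP o _ _ y y'.
(* [potential_step] asks for a head other than o; an edge into o is traversed backwards, with
   increment -1. *)
have [x'o|x'o] := eqVneq x' o.
  have xo : x != o by rewrite -x'o.
  have x'x : x' != x by rewrite eq_sym.
  rewrite -[LHS]opprB (step x' x (-1)) //; first by rewrite ![(x' == _) && _]andbC; ring.
  move=> i j; rewrite -[LHS](subrK (y i j)) addrC dy; congr (_ + _).
  by rewrite [o == x]eq_sym (negPf xo) ![(_ == x') && _]andbC; ring.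
rewrite (step x x' 1) // ?mul1r // => i j.
by rewrite -[LHS](subrK (y i j)) addrC dy [o == x']eq_sym (negPf x'o) /=; ring.
Qed.

End Complete.

(** * Large primes are not radical *)

From mathcomp Require Import fingroup perm.

Lemma perm_pair (T : finType) (a b x y : T) : a != b -> x != y ->
  exists s : {perm T}, s a = x /\ s b = y.
Proof.
move=> ab xy; exists (tperm a x * tperm (tperm a x b) y)%g.
rewrite !permM tpermL; split; last by rewrite tpermL.
rewrite tpermD //; last by rewrite eq_sym.
by rewrite -{2}[x](tpermL a) (inj_eq perm_inj) eq_sym.
Qed.

Section Permutations.
Variables (n : nat) (K : ograph).
Hypothesis complK : is_complete_graph n K.
Hypothesis n_gt1 : (1 < n)%N.
Local Notation E := (edge K).
Local Notation V := (vertex K).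

Definition rank (f : {perm V}) (v : V) : nat := enum_rank (f v).

Lemma rank_lt f v : (rank f v < n)%N.
Proof. by case: complK => <- _ _; apply: ltn_ord. Qed.

Lemma rank_eq f v w : (rank f v == rank f w) = (v == w).
Proof. by rewrite -[RHS](inj_eq (@perm_inj _ f)) -[RHS](inj_eq enum_rank_inj). Qed.

Lemma rank_tperm f x y v : rank (tperm x y * f)%g v = rank f (tperm x y v).
Proof. by rewrite /rank permM. Qed.

Lemma sum_rank_eq (R : pzSemiRingType) f (k : nat) :
  \sum_v (rank f v == k)%:R = (k < n)%:R :> R.
Proof.
case: ltnP => [lt_kn|le_nk]; last first.
  by apply: big1 => v _; rewrite ltn_eqF // (leq_trans (rank_lt f v)).
have lt_kV : (k < #|V|)%N by case: complK => ->.
rewrite (bigD1 (f^-1 (enum_val (Ordinal lt_kV)))%g) //= {1}/rank permKV enum_valK eqxx.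
rewrite big1 ?addr0 // => v; rewrite -(rank_eq f) {2}/rank permKV enum_valK /=.
by move/negPf ->.
Qed.

Lemma rot_subproof : injective (fun v : V => enum_val (ord_pred (enum_rank v))).
Proof. by move=> v w /enum_val_inj/ord_pred_inj/enum_rank_inj. Qed.

(** It permutes the positions cyclically, lowering each by one; applied after f it moves the first
    vertex of the ordering to the end. *)
Definition rot_perm : {perm V} := perm rot_subproof.

Lemma rank_rot f v :
  rank (f * rot_perm)%g v = if rank f v == 0%N then n.-1 else (rank f v).-1.
Proof.
have cV : #|V| = n by case: complK.
rewrite /rank permM permE enum_valK /=.
have := rank_lt f v; rewrite /rank; move: (nat_of_ord _) => k lt_kn; rewrite cV.
case: eqP => [->|k0]; first by rewrite add0n modn_small //; lia.
have -> : ((k + n).-1 = k.-1 + n)%N by lia.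
by rewrite modnDr modn_small //; lia.
Qed.

Section Solution.
Variable p : nat.
Local Notation U := (B1 p K).
Local Notation W := (quot_space U).

Definition inversions (f : {perm V}) : {ffun E -> ('F_p)^o} :=
  [ffun s => (rank f (target s) < rank f (source s))%N%:R].

Definition place (f : {perm V}) : W := (\pi_W (inversions f))%qT.

(** Each ordering f in which the source of s immediately precedes its target gives the edge from
    [place f] to the place of the swapped ordering. Orderings may share a place in W, and the chain
    counts them with multiplicity. *)
Definition perm_solution (s : E) : chain1 U :=
  \sum_(f : {perm V} | rank f (target s) == (rank f (source s)).+1)
    [ffun e => (e == (place f, s))%:R].

(** Exchanging two consecutive vertices reverses no other pair, and no other edge of K joins these
    two. *)
Lemma inversions_tperm f (s : E) : rank f (target s) = (rank f (source s)).+1 ->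
  inversions (tperm (source s) (target s) * f)%g = inversions f + basis_vec p s.
Proof.
move=> rs; apply/ffunP => t; rewrite !ffunE !rank_tperm.
have [->|ts] := eqVneq t s.
  by rewrite tpermL tpermR rs ltnS leqnn ltnNge leqnSn /= add0r.
rewrite addr0; congr (_%:R); congr nat_of_bool.
have st := edge_neq complK s; have tt := edge_neq complK t.
have nst : ~~ ((source t == source s) && (target t == target s) ||
              (source t == target s) && (target t == source s)).
  rewrite -set2_eqE; apply: contraNneq ts => eq_ts.
  have [_ _ /(_ _ _ st) [s0 [_ s0U]]] := complK.
  by rewrite -(s0U s erefl) -(s0U t eq_ts).
have tE v : rank f (tperm (source s) (target s) v) =
    if v == source s then rank f (target s) else if v == target s then rank f (source s) else rank f v.
  case: tpermP => [->|->|/eqP/negPf-> /eqP/negPf-> //]; first by rewrite eqxx.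
  by rewrite eq_sym (negPf st) eqxx.
move: nst tt; rewrite !tE -!(rank_eq f) rs.
move: (rank f (source s)) (rank f (source t)) (rank f (target t)) => k a b {tE rs}.
by case: (eqVneq b k); case: (eqVneq b k.+1); case: (eqVneq a k); case: (eqVneq a k.+1);
  rewrite /=; lia.
Qed.

Lemma boundary_perm_solution (s : E) (w : W) : boundary (perm_solution s) w =
  \sum_f ((rank f (source s) == (rank f (target s)).+1)%:R
        - (rank f (target s) == (rank f (source s)).+1)%:R) * (w == place f)%:R.
Proof.
pose adj (f : {perm V}) u v : 'F_p := (rank f v == (rank f u).+1)%:R.
transitivity (\sum_f adj f (source s) (target s) *
    ((w == place f + color_dir U s)%:R - (w == place f)%:R)).
  rewrite boundaryE /perm_solution; under eq_bigr do rewrite sum_ffunE mulr_suml.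
  rewrite (exchange_big_dep predT) //=; apply: eq_bigr => f _.
  rewrite /adj; case: eqP => rs; last by rewrite big_pred0 // mul0r.
  rewrite (bigD1 (place f, s)) //= ffunE eqxx mul1r big1 ?addr0 ?mul1r // => e /negPf ne.
  by rewrite ffunE ne mul0r.
under eq_bigr do rewrite mulrBr; under [RHS]eq_bigr do rewrite mulrBl.
rewrite [LHS]sumrB [RHS]sumrB; congr (_ - _).
(* Reindexing by the swap turns the final vertex of the edge from [place f] into the place of the
   swapped ordering. *)
rewrite [RHS](reindex_inj (mulgI (tperm (source s) (target s)))) /=.
apply: eq_bigr => f _; rewrite !rank_tperm tpermL tpermR /adj.
case: eqP => [rs|_]; last by rewrite !mul0r.
by rewrite {2}/place inversions_tperm // pi_quotD.
Qed.

(** When v passes from first to last, exactly the edges at v change their inversion status, with the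
    signs of the coboundary of v. *)
Lemma place_rot f v : rank f v = 0%N -> place (f * rot_perm)%g = place f.
Proof.
move=> fv0; apply/eq_pi_quot; rewrite -rpredN opprB.
rewrite (_ : _ - _ = coboundary p v) ?coboundary_B1 //.
apply/ffunP => s; rewrite coboundaryE !ffunE !rank_rot.
have eq_v w : (w == v) = (rank f w == 0%N) by rewrite -fv0 rank_eq.
rewrite !eq_v; have := edge_neq complK s; rewrite -(rank_eq f).
have := rank_lt f (source s); have := rank_lt f (target s).
move: (rank f _) (rank f _) => k l lt_k lt_l kl.
have ltn_pred : k != 0%N -> l != 0%N -> (l.-1 < k.-1)%N = (l < k)%N by clear; lia.
have ltn_last : l != 0%N -> (l.-1 < n.-1)%N by clear -lt_k lt_l; lia.
have last_ltn : (n.-1 < k.-1)%N = false by clear -lt_k lt_l; lia.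
have [k0|k0] := eqVneq k 0%N; have [l0|l0] := eqVneq l 0%N.
- by rewrite k0 l0 eqxx in kl.
- by rewrite ltn_last // k0 ltn0 !sub0r.
- by rewrite last_ltn l0 lt0n k0.
by rewrite ltn_pred // !subrr.
Qed.

(** The rotation is a bijection from the orderings with v first to those with v last, and it
    preserves places. *)
Lemma sum_place_ends v (w : W) :
  \sum_f ((rank f v == 0%N)%:R - (rank f v == n.-1)%:R) * (w == place f)%:R = 0 :> 'F_p.
Proof.
under eq_bigr do rewrite mulrBl.
rewrite sumrB [X in _ - X](reindex_inj (mulIg rot_perm)) /= -sumrB big1 // => f _.
have -> : (rank (f * rot_perm)%g v == n.-1) = (rank f v == 0%N).
  by rewrite rank_rot; have := rank_lt f v; clear -n_gt1; case: (eqVneq (rank f v) 0%N); lia.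
by case: eqP => [fv0|_]; [rewrite (place_rot fv0) subrr | rewrite !mul0r subrr].
Qed.

(** The sign of the coboundary cancels the dependence on orientations: in an ordering f, the
    neighbour right after v counts +1 and the one right before v counts -1. They cancel unless v
    stands at an end, and [sum_place_ends] disposes of the ends. *)
Lemma vertex_relation v (w : W) :
  \sum_s (coboundary p v s : 'F_p) * boundary (perm_solution s) w = 0.
Proof.
pose G f u : 'F_p := (rank f u == (rank f v).+1)%:R - (rank f v == (rank f u).+1)%:R.
rewrite -[RHS](sum_place_ends v w).
transitivity (\sum_f \sum_s (coboundary p v s *
   ((rank f (source s) == (rank f (target s)).+1)%:R
        - (rank f (target s) == (rank f (source s)).+1)%:R)) * (w == place f)%:R : 'F_p).
  rewrite exchange_big; apply: eq_bigr => s _.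
  by rewrite boundary_perm_solution mulr_sumr; apply: eq_bigr => f _; rewrite mulrA.
apply: eq_bigr => f _; rewrite -mulr_suml; congr (_ * _).
transitivity (\sum_u G f u); last first.
  rewrite sumrB sum_rank_eq.
  have -> : \sum_u (rank f v == (rank f u).+1)%:R = (rank f v != 0%N)%:R :> 'F_p.
    have [fv0|fv0] := eqVneq (rank f v) 0%N.
      by apply: big1 => u _; rewrite fv0.
    rewrite -[RHS](_ : ((rank f v).-1 < n)%N%:R = _); last first.
      by congr (_%:R); have := rank_lt f v; clear; lia.
    rewrite -(sum_rank_eq _ f); apply: eq_bigr => u _; congr (_%:R).
    by rewrite -{1}(prednK (n := rank f v)) ?lt0n // eqSS eq_sym.
  have -> : (rank f v == n.-1) = ~~ ((rank f v).+1 < n)%N.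
    by have := rank_lt f v; clear -n_gt1; lia.
  by case: (_ < n)%N; case: (_ == 0%N) => /=; ring.
transitivity (\sum_u \sum_s ((arrow s u v)%:R + (arrow s v u)%:R) * G f u); last first.
  apply: eq_bigr => u _; rewrite -mulr_suml.
  have [->|uv] := eqVneq u v; first by rewrite /G subrr mulr0.
  by rewrite (sum_arrow complK) // mul1r.
rewrite exchange_big; apply: eq_bigr => s _ /=.
under [RHS]eq_bigr do rewrite mulrDl; rewrite big_split coboundaryE mulrBl /=.
have pick x (P : bool) : \sum_u ((x == u) && P)%:R * G f u = P%:R * G f x.
  rewrite (bigD1 x) //= eqxx big1 ?addr0 // => u /negPf ux.
  by rewrite eq_sym ux mul0r.
rewrite pick; under [X in _ = _ + X]eq_bigr do rewrite /arrow andbC.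
rewrite pick -mulrN opprB; congr (_ + _).
  by case: eqP => [tv|_]; rewrite ?mul0r // /G tv.
by case: eqP => [sv|_]; rewrite ?mul0r // /G sv.
Qed.

Lemma perm_solutionP : is_solution perm_solution.
Proof.
split=> [s w t ts|c cU].
  rewrite /perm_solution sum_ffunE big1 // => f _; rewrite ffunE xpair_eqE.
  by rewrite (negPf ts) andbF.
apply/ffunP => w; rewrite boundary_sumZ ffunE; rewrite sum_basis_vec in cU.
have [phi cE] := B1_coboundaries cU.
transitivity (\sum_v phi v * \sum_s (coboundary p v s : 'F_p) * boundary (perm_solution s) w).
  under [RHS]eq_bigr do rewrite mulr_sumr.
  rewrite exchange_big; apply: eq_bigr => s _ /=.
  have := cE s; rewrite ffunE => ->; rewrite mulr_suml.
  by apply: eq_bigr => v _; rewrite mulrA.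
by apply: big1 => v _; rewrite vertex_relation mulr0.
Qed.

Lemma profile_perm_solution s : color_profile perm_solution s =
  #|[pred f | rank f (target s) == (rank f (source s)).+1]|%:R.
Proof.
rewrite ffunE -sum1_card natr_sum.
transitivity (\sum_w \sum_(f : {perm V} | rank f (target s) == (rank f (source s)).+1)
   (w == place f)%:R : 'F_p).
  apply: eq_bigr => w _; rewrite /perm_solution sum_ffunE; apply: eq_bigr => f _.
  by rewrite ffunE xpair_eqE eqxx andbT.
rewrite exchange_big; apply: eq_bigr => f _.
by rewrite (bigD1 (place f)) //= eqxx big1 ?addr0 // => w /negPf ->.
Qed.

End Solution.

(** The symmetric group is doubly transitive, and composing with a permutation that carries one pair
    to the other is a bijection on orderings. This makes the profile of [perm_solution] constant. *)
Lemma card_adjacent (x y x' y' : V) : x != y -> x' != y' ->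
  #|[pred f | rank f y == (rank f x).+1]| = #|[pred f | rank f y' == (rank f x').+1]|.
Proof.
move=> xy xy'; have [g [<- <-]] := perm_pair xy xy'.
rewrite -!sum1_card [LHS](reindex_inj (mulgI g)) /=.
by apply: eq_bigl => f; rewrite !inE /rank !permM.
Qed.

Lemma card_adjacent_gt0 (x y : V) : x != y -> (0 < #|[pred f | rank f y == (rank f x).+1]|)%N.
Proof.
have cV : (1 < #|V|)%N by case: complK => ->.
pose v0 : V := enum_val (Ordinal (ltnW cV)); pose v1 : V := enum_val (Ordinal cV).
have v01 : v0 != v1 by rewrite (inj_eq enum_val_inj).
move=> /(card_adjacent v01) <-; apply/card_gt0P; exists 1%g.
by rewrite inE /rank !perm1 !enum_valK.
Qed.

Lemma radical_prime_bound (p : nat) : radical_prime K p -> (p <= #|{perm V}|)%N.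
Proof.
move=> [pr_p rad]; rewrite leqNgt; apply/negP => lt_p.
have cV : (1 < #|V|)%N by case: complK => ->.
pose v0 : V := enum_val (Ordinal (ltnW cV)); pose v1 : V := enum_val (Ordinal cV).
have v01 : v0 != v1 by rewrite (inj_eq enum_val_inj).
have [_ _ /(_ _ _ v01) [s _]] := complK.
have := rad _ (perm_solutionP p); move/(_ _)/ffunP/(_ s).
rewrite profile_perm_solution ffunE.
set N := #|_|.
have N_lt : (0 < N < p)%N.
  by rewrite card_adjacent_gt0 ?(edge_neq complK) //= (leq_ltn_trans (max_card _)).
have N0 : N%:R != 0 :> 'F_p.
  rewrite -(dvdn_pcharf (pchar_Fp pr_p)) gtnNdvd //; by case/andP: N_lt.
move=> N_eq0; case/eqP: N0; apply: N_eq0.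
exists (N%:R) => t; rewrite profile_perm_solution; congr (_%:R).
exact: card_adjacent (edge_neq complK t) (edge_neq complK s).
Qed.

End Permutations.

(** * The radical distance *)

From mathcomp Require Import all_classical all_reals all_analysis.

(** A big operator over an infinite support collapses to its neutral element, so a bound such as
    [radical_prime_bound] is what allows the product to be computed factor by factor. *)
Lemma fsbig_bounded (R : Type) (idx : R) (op : Monoid.com_law idx) (P : set nat) (m : nat)
    (F : nat -> R) : (forall p, P p -> (p < m)%N) ->
  \big[op/idx]_(p \in P) F p = \big[op/idx]_(0 <= p < m | `[< P p >]) F p.
Proof.
move=> Pm; rewrite [RHS]bigfs ?iota_uniq //.
  by apply: eq_fsbigl; apply/seteqP; split=> p /asboolP.
by move=> p /asboolP/Pm lt_pm; rewrite mem_index_iota lt_pm.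
Qed.

Section CompleteGraph.
Variables (n : nat) (K : ograph).
Hypotheses (complK : is_complete_graph n K) (n_gt1 : (1 < n)%N).

Lemma dvdn_radical_distance (p : nat) : radical_prime K p -> (p %| radical_distance K)%N.
Proof.
move=> rad_p; have bound := radical_prime_bound complK n_gt1.
rewrite /radical_distance (fsbig_bounded _ (m := #|{perm vertex K}|.+1)) //.
rewrite big_mkord (bigD1 (Ordinal (bound p rad_p : (p < _.+1)%N))) /=.
  exact: dvdn_mulr.
exact/asboolP.
Qed.

Lemma primorial_leq_radical_distance : (primorial (n.-1)./2 <= radical_distance K)%N.
Proof.
have bound := radical_prime_bound complK n_gt1; set m := (n.-1)./2.
(* B exceeds both the bound on radical primes and m, so both products run over the same range. *)
pose B := (#|{perm vertex K}| + m).+1.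
rewrite /radical_distance (fsbig_bounded _ (m := B)) => [|p /bound]; last first.
  by rewrite /B ltnS => /leq_trans -> //; apply: leq_addr.
rewrite /primorial -(big_mkord prime id) (big_nat_widen _ _ B) ?ltnS ?leq_addl //.
rewrite [X in (X <= _)%N]big_mkcond [X in (_ <= X)%N]big_mkcond /=.
apply: leq_prod => p _; case: asboolP => [[/prime_gt0 p_gt0 _]|nrad]; first by case: ifP.
case: ifP => // /andP[pr_p]; rewrite ltnS => le_pm; case: nrad => /=.
by apply: (radical_prime_complete complK pr_p); move: le_pm n_gt1; rewrite /m; lia.
Qed.

Lemma ler_half_pred (R : realType) (p : nat) :
  (p%:R <= (n%:R - 1) / 2 :> R) = (2 * p + 1 <= n)%N.
Proof. by rewrite ler_pdivlMr // lerBrDr -natrM -(natrD _ _ 1) ler_nat mulnC. Qed.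

Lemma expR_chebyshev_theta (R : realType) :
  expR (chebyshev_theta ((n%:R - 1) / 2 : R)) = (primorial (n.-1)./2)%:R.
Proof.
rewrite /chebyshev_theta (fsbig_bounded _ (m := ((n.-1)./2).+1)) => [|p /= []]; last first.
  by rewrite ler_half_pred => _; move: n_gt1; lia.
rewrite big_mkord expR_sum /primorial natr_prod.
apply: eq_big => p; last first.
  by move=> /asboolP[pr_p _]; rewrite lnK // posrE ltr0n prime_gt0.
apply/asboolP/idP => [[]//|pr_p]; split=> //.
by rewrite ler_half_pred; have := ltn_ord p; move: n_gt1; lia.
Qed.

End CompleteGraph.

Theorem corollary1p6 (R : realType) :
  (forall (n : nat) (K : ograph), (2 <= n)%N -> is_complete_graph n K ->
     (forall p : nat, prime p -> p%:R <= (n%:R - 1) / 2 :> R ->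
        (p %| radical_distance K)%N) /\
     expR (chebyshev_theta ((n%:R - 1) / 2 : R)) <= (radical_distance K)%:R) /\
  (exists C : R, 1 < C /\
     exists N : nat, forall (n : nat) (K : ograph),
       (N <= n)%N -> is_complete_graph n K ->
       C ^+ n <= (radical_distance K)%:R).
Proof.
split=> [n K n_gt1 complK|].
  split=> [p pr_p|]; last first.
    by rewrite expR_chebyshev_theta // ler_nat (primorial_leq_radical_distance complK).
  rewrite ler_half_pred => le_pn; apply: (dvdn_radical_distance complK n_gt1).
  exact: (radical_prime_complete complK pr_p le_pn).
(* With C the 64th root of 2, the bound becomes 2^n <= d^64, which is [primorial_expn]; the
   threshold for n below is the one required there. *)
pose C : R := 2 `^ (64%:R^-1).
have C_ge0 : 0 <= C by apply: powR_ge0.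
have C64 : C ^+ 64 = 2 by rewrite -powR_mulrn // -powRrM mulVf ?powRr1 ?pnatr_eq0.
exists C; split.
  by rewrite ltNge; apply/negP => /(exprn_ile1 64 C_ge0); rewrite C64 leNgt ltr1n.
exists (2 * 4 ^ 6 + 1)%N => n K n_ge complK.
have n_gt1 : (1 < n)%N by apply: leq_trans n_ge.
rewrite -(@ler_pXn2r _ 64) ?nnegrE ?exprn_ge0 ?ler0n //.
rewrite -exprM mulnC exprM C64 -!natrX ler_nat.
apply: leq_trans (primorial_expn n_ge) _.
by rewrite leq_exp2r // (primorial_leq_radical_distance complK).
Qed.
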